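(* Let $A$ and $B$ be $n\times n$ type-II matrices and let $R,S$ be $n\times n$ complex matrices. The following are equivalent: (a) $R\in\mathcal N_{A,B}$ and $S=\Theta_{A,B}(R)$; (b) $X_R\Delta_BX_A=\Delta_BX_A\Delta_S$; (c) $X_R\Delta_AX_B=\Delta_AX_B\Delta_{S^T}$; (d) $\Delta_{B^T}X_{(B^{(-)})^T}\Delta_{nR}=X_{S^T}\Delta_{(A^{(-)})^T}X_{A^T}$; (e) $\Delta_{(A^{(-)})^T}X_{A^T}\Delta_{nR^T}=X_S\Delta_{B^T}X_{(B^{(-)})^T}$.
   Context: All matrices are complex; compositions of operators are read right to left. For $n\times n$ matrices $X,Y$, $X\circ Y$ is the Schur (entrywise) product; if $X$ has no zero entry, $X^{(-)}$ is its Schur inverse, $(X^{(-)})_{ij}=1/X_{ij}$. An $n\times n$ matrix $W$ is type-II if $W(W^{(-)})^T=nI$. For an $n\times n$ matrix $C$, $X_C$ and $\Delta_C$ are the linear operators on $M_n(\mathbb C)$ given by $X_C(M)=CM$ and $\Delta_C(M)=C\circ M$. With $e_1,\dots,e_n$ the standard basis of $\mathbb C^n$, $\mathcal N_{A,B}$ is the set of $n\times n$ matrices $M$ such that every vector $Ae_i\circ Be_j$ ($1\le i,j\le n$) is an eigenvector of $M$, and for $M\in\mathcal N_{A,B}$, $\Theta_{A,B}(M)$ is the $n\times n$ matrix with $M(Ae_i\circ Be_j)=\Theta_{A,B}(M)_{ij}(Ae_i\circ Be_j)$. *)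

(* Defs.v *)
From HB Require Import structures.
From mathcomp Require Import all_boot all_order all_algebra.
From mathcomp Require Import boolp classical_sets reals.
From mathcomp Require Export complex.

Set Implicit Arguments.
Unset Strict Implicit.
Unset Printing Implicit Defensive.

Import GRing.Theory.
Local Open Scope ring_scope.

Section Defs.
Variables (F : fieldType) (n : nat).
Implicit Types (A B C M W : 'M[F]_n).

Definition schur m p (X Y : 'M[F]_(m, p)) : 'M[F]_(m, p) := map2_mx *%R X Y.

(* Meaningful only when X has no zero entry, since 0^-1 = 0. *)
Definition schur_inv m p (X : 'M[F]_(m, p)) : 'M[F]_(m, p) :=
  map_mx (fun x => x^-1) X.

(* The absence of zero entries is what makes W^(-) defined. *)
Definition type_II W : Prop :=
  (forall i j, W i j != 0) /\ W *m (schur_inv W)^T = n%:R%:M.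

Definition Xop C : 'M[F]_n -> 'M[F]_n := fun M => C *m M.

Definition Deltaop C : 'M[F]_n -> 'M[F]_n := fun M => schur C M.

Fact Xop_is_linear C : linear (Xop C).
Proof. by move=> a M N; rewrite /Xop linearP. Qed.

Fact Deltaop_is_linear C : linear (Deltaop C).
Proof.
by move=> a M N; apply/matrixP=> i j; rewrite !mxE mulrDr mulrCA.
Qed.

HB.instance Definition _ C :=
  GRing.isLinear.Build F 'M[F]_n 'M[F]_n _ (Xop C) (Xop_is_linear C).
HB.instance Definition _ C :=
  GRing.isLinear.Build F 'M[F]_n 'M[F]_n _ (Deltaop C) (Deltaop_is_linear C).

Definition std_basis (i : 'I_n) : 'cV[F]_n := delta_mx i 0.

Definition schur_vec A B (i j : 'I_n) : 'cV[F]_n :=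
  schur (A *m std_basis i) (B *m std_basis j).

Definition is_eigenvector M (v : 'cV[F]_n) : Prop :=
  v != 0 /\ exists l : F, M *m v = l *: v.

Definition Nomura A B : set 'M[F]_n :=
  [set M | forall i j, is_eigenvector M (schur_vec A B i j)].

(* On Nomura A B the eigenvalue picked by xget exists and is unique; the
   default value 0 is used only outside Nomura A B. *)
Definition Theta A B M : 'M[F]_n :=
  \matrix_(i, j)
    xget 0 [set l : F | M *m schur_vec A B i j = l *: schur_vec A B i j].

End Defs.

Notation "X ^(-)" := (schur_inv X) (at level 2, format "X ^(-)") : ring_scope.

(* Main.v *)
Require Import Defs.
From mathcomp Require Import all_boot all_order all_algebra.
From mathcomp Require Import boolp classical_sets reals.
From mathcomp Require Import ring.

(** Evaluated on matrix units, each of (b)-(e) becomes a family of scalar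
    identities.  Those of (b) and (c) are both the eigenvector equations
    [\sum_l R k l * (A l i * B l j) = S i j * (A k i * B k j)], and those of
    (d) are obtained from them by dividing by [A q i * B k j] and summing over
    [i], because [A *m (A^(-))^T = n I]; the step is undone with
    [(A^(-))^T *m A = n I].  Exchanging [A] with [B] and [S] with [S^T]
    preserves the eigenvector equations and turns (d) into (e). *)

Set Implicit Arguments.
Unset Strict Implicit.
Unset Printing Implicit Defensive.

Import GRing.Theory Num.Theory.
Local Open Scope ring_scope.

Section Field.
Variables (F : fieldType) (n : nat).
Implicit Types A B C P Q R S T U V Z : 'M[F]_n.

Lemma eqfun_sym (aT rT : Type) (f g : aT -> rT) : f =1 g <-> g =1 f.
Proof. by split=> /fsym. Qed.

Lemma eq_linear_delta (f g : {linear 'M[F]_n -> 'M[F]_n}) :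
  (forall i j, f (delta_mx i j) = g (delta_mx i j)) -> f =1 g.
Proof.
move=> fg M; rewrite (matrix_sum_delta M) !linear_sum.
apply: eq_bigr => i _; rewrite !linear_sum; apply: eq_bigr => j _.
by rewrite !linearZ /= fg.
Qed.

Lemma mulmx_delta_entry C (i j p q : 'I_n) :
  (C *m delta_mx i j) p q = C p i *+ (q == j).
Proof.
rewrite mxE (bigD1 i) //= big1 => [|l /negPf li]; rewrite mxE ?li ?mulr0 //.
by rewrite eqxx addr0 /= mulr_natr.
Qed.

(** Left matrix products and Schur products both preserve the span of the matrix units in a given
    column, so the image of [delta_mx i j] lives in column [j]; hence the factor [q == j]. *)
Lemma XDX_delta_entry P Q T i j p q :
  (Xop P \o Deltaop Q \o Xop T) (delta_mx i j) p q
  = (\sum_l P p l * (Q l q * T l i)) *+ (q == j).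
Proof.
rewrite /= mxE -sumrMnl; apply: eq_bigr => l _.
by rewrite mxE mulmx_delta_entry -!mulrnAr.
Qed.

Lemma DXD_delta_entry U V Z i j p q :
  (Deltaop U \o Xop V \o Deltaop Z) (delta_mx i j) p q
  = (U p q * (V p i * Z i q)) *+ (q == j).
Proof.
(* A matrix unit is an eigenvector of every Schur multiplication, here with eigenvalue [Z i j]. *)
have -> : (Deltaop U \o Xop V \o Deltaop Z) (delta_mx i j)
          = Deltaop U (Xop V (Z i j *: delta_mx i j)).
  congr (Deltaop U (Xop V _)); apply/matrixP => k l; rewrite !mxE.
  by case: eqP => [->|_]; case: eqP => [->|_] //=; rewrite !mulr0.
rewrite linearZ /= mxE mxE mulmx_delta_entry.
by case: eqP => [->|_]; rewrite ?mulr0n ?mulr0 // !mulr1n (mulrC (Z i j)).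
Qed.

Lemma XDX_eq_DXD P Q T U V Z :
  Xop P \o Deltaop Q \o Xop T =1 Deltaop U \o Xop V \o Deltaop Z <->
  (forall p i q, \sum_l P p l * (Q l q * T l i) = U p q * (V p i * Z i q)).
Proof.
split=> [eqPU p i q | eqPU].
  have := congr1 (fun M : 'M_n => M p q) (eqPU (delta_mx i q)).
  by rewrite XDX_delta_entry DXD_delta_entry eqxx.
apply: eq_linear_delta => i j; apply/matrixP => p q.
by rewrite XDX_delta_entry DXD_delta_entry eqPU.
Qed.

Definition eigen_eqs A B R S : Prop :=
  forall k i j,
    \sum_l R k l * (A l i * B l j) = S i j * (A k i * B k j).

Definition dual_eqs A B R S : Prop :=
  forall k p q,
    \sum_r S r p * ((A q r)^-1 * A k r)
    = B q p * ((B k p)^-1 * (n%:R * R k q)).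

Lemma eigen_eqs_sym A B R S : eigen_eqs A B R S <-> eigen_eqs B A R S^T.
Proof.
split=> E k i j; have := E k j i; rewrite ?mxE => Ek.
  by rewrite [B k i * _]mulrC -Ek; apply: eq_bigr => l _; ring.
by rewrite [A k i * _]mulrC -Ek; apply: eq_bigr => l _; ring.
Qed.

Lemma XDX_eigen A B R S :
  Xop R \o Deltaop B \o Xop A =1 Deltaop B \o Xop A \o Deltaop S <->
  eigen_eqs A B R S.
Proof.
rewrite XDX_eq_DXD; split=> E k i j.
  transitivity (B k j * (A k i * S i j)); last by ring.
  by rewrite -E; apply: eq_bigr => l _; ring.
transitivity (S i j * (A k i * B k j)); last by ring.
by rewrite -E; apply: eq_bigr => l _; ring.
Qed.

Lemma DXD_dual A B R S :
  Deltaop B^T \o Xop (B^(-))^T \o Deltaop (n%:R *: R)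
    =1 Xop S^T \o Deltaop (A^(-))^T \o Xop A^T <->
  dual_eqs A B R S.
Proof.
rewrite (eqfun_sym _ _) XDX_eq_DXD; split=> E k p q.
  have := E p k q; rewrite !mxE => <-.
  by apply: eq_bigr => r _; rewrite !mxE.
by rewrite !mxE -E; apply: eq_bigr => r _; rewrite !mxE.
Qed.

(** Compared with (d) for the pair [B], [A], the Schur inverses sit on the other factors, which
    exchanges the two row indices; the transpose on [R] undoes this exchange. *)
Lemma DXD_dual_tr A B R S :
  Deltaop (A^(-))^T \o Xop A^T \o Deltaop (n%:R *: R^T)
    =1 Xop S \o Deltaop B^T \o Xop (B^(-))^T <->
  dual_eqs B A R S^T.
Proof.
rewrite (eqfun_sym _ _) XDX_eq_DXD; split=> E k p q.
  transitivity (\sum_r S p r * (B^T r k * (B^(-))^T r q)).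
    by apply: eq_bigr => r _; rewrite !mxE; ring.
  by rewrite E !mxE; ring.
transitivity (\sum_r S^T r k * ((B p r)^-1 * B q r)).
  by apply: eq_bigr => r _; rewrite !mxE; ring.
by rewrite E !mxE; ring.
Qed.

Lemma schur_vecE A B i j k : schur_vec A B i j k 0 = A k i * B k j.
Proof.
by rewrite /schur_vec /std_basis -!colE !mxE.
Qed.

Lemma eigen_eqs_vec A B R S :
  eigen_eqs A B R S <->
  (forall i j, R *m schur_vec A B i j = S i j *: schur_vec A B i j).
Proof.
split=> [E i j | E k i j].
  apply/matrixP => k l; rewrite ord1 [LHS]mxE [RHS]mxE schur_vecE -E.
  by apply: eq_bigr => r _; rewrite schur_vecE.
have := congr1 (fun v : 'cV_n => v k 0) (E i j).
rewrite [LHS]mxE [RHS]mxE schur_vecE => <-.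
by apply: eq_bigr => r _; rewrite schur_vecE.
Qed.

Lemma schur_vec_neq0 A B i j :
  type_II A -> type_II B -> schur_vec A B i j != 0.
Proof.
move=> [A0 _] [B0 _]; apply/eqP => /(congr1 (fun v : 'cV_n => v i 0)).
rewrite schur_vecE mxE => /eqP.
by rewrite mulf_eq0 (negPf (A0 _ _)) (negPf (B0 _ _)).
Qed.

Lemma Nomura_eigen A B R S : type_II A -> type_II B ->
  (Nomura A B R /\ S = Theta A B R) <-> eigen_eqs A B R S.
Proof.
move=> hA hB; rewrite eigen_eqs_vec; split=> [[NR ->] i j | E].
  rewrite mxE; case: xgetP => [l -> // | none].
  by have [_ [l /none]] := NR i j.
split=> [i j|]; first by split; [exact: schur_vec_neq0 | exists (S i j)].
(* A nonzero vector has at most one eigenvalue, so the chosen [l] must be [S i j]. The default value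
   cannot occur, since [S i j] is a candidate by [E]. *)
apply/matrixP => i j; rewrite mxE; case: xgetP => [l -> /= | /(_ (S i j))].
  rewrite E => /eqP; rewrite -subr_eq0 -scalerBl scaler_eq0.
  by rewrite (negPf (schur_vec_neq0 i j hA hB)) orbF subr_eq0 => /eqP.
by case; exact: E.
Qed.

Lemma type_II_rows A k q : type_II A ->
  \sum_r A k r * (A q r)^-1 = n%:R *+ (k == q).
Proof.
case=> _ /(congr1 (fun M : 'M_n => M k q)); rewrite !mxE => <-.
by apply: eq_bigr => r _; rewrite !mxE.
Qed.

End Field.

Section NumField.
Variables (F : numFieldType) (n : nat).
Implicit Types (A B R S : 'M[F]_n).

(** A one-sided inverse of a square matrix is two-sided. This requires dividing by [n], which is
    nonzero in [F]: the index [i] forces [n > 0], and the characteristic is zero. *)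
Lemma type_II_cols A i j : type_II A ->
  \sum_q (A q i)^-1 * A q j = n%:R *+ (i == j).
Proof.
case=> _ AV.
have n0 : n%:R != 0 :> F by rewrite pnatr_eq0 -lt0n (leq_ltn_trans _ (ltn_ord i)).
have : ((n%:R)^-1 *: (A^(-))^T) *m A = 1%:M.
  by apply: mulmx1C; rewrite -scalemxAr AV scale_scalar_mx mulVf.
rewrite -scalemxAl => /(congr1 (fun M : 'M_n => n%:R * M i j)).
rewrite !mxE mulVKf // mulr_natr => <-.
by apply: eq_bigr => q _; rewrite !mxE.
Qed.

Lemma eigen_eqs_dual A B R S : type_II A -> type_II B ->
  eigen_eqs A B R S <-> dual_eqs A B R S.
Proof.
move=> hA hB; have [[A0 _] [B0 _]] := (hA, hB); split=> [E k p q | D k i j].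
  transitivity
    (\sum_r \sum_l (B k p)^-1 * (R k l * B l p) * (A l r * (A q r)^-1)).
    apply: eq_bigr => r _.
    transitivity ((B k p)^-1 * (A q r)^-1 * (S r p * (A k r * B k p))).
      by field; rewrite A0 B0.
    rewrite -E mulr_sumr; apply: eq_bigr => l _.
    by ring.
  (* Row orthogonality of [A] leaves only the term [l = q]. *)
  rewrite exchange_big /=; under eq_bigr do rewrite -mulr_sumr type_II_rows //.
  rewrite (bigD1 q) //= big1 => [|l /negPf ->]; last by rewrite mulr0n mulr0.
  by rewrite eqxx addr0 mulr1n; ring.
have n0 : n%:R != 0 :> F by rewrite pnatr_eq0 -lt0n (leq_ltn_trans _ (ltn_ord i)).
apply: (mulfI n0).
(* The weight [B k j * A q i] turns the right-hand side of [D k j q] into [n] times the [q]-th term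
   of the eigenvector equation. *)
transitivity (\sum_q B k j * A q i * (B q j * ((B k j)^-1 * (n%:R * R k q)))).
  rewrite mulr_sumr; apply: eq_bigr => q _.
  by field; rewrite B0.
under eq_bigr do rewrite -D mulr_sumr.
rewrite exchange_big /=.
transitivity (\sum_r B k j * (S r j * A k r) * \sum_q (A q r)^-1 * A q i).
  apply: eq_bigr => r _; rewrite mulr_sumr; apply: eq_bigr => q _.
  by ring.
(* Column orthogonality of [A] leaves only [r = i], with the factor [n] that was introduced
   above. *)
under eq_bigr do rewrite type_II_cols //.
rewrite (bigD1 i) //= big1 => [|r /negPf ->]; last by rewrite mulr0n mulr0.
by rewrite eqxx addr0 mulr1n; ring.
Qed.

End NumField.

Theorem theorem3p2 (K : realType) (n : nat) (A B R S : 'M[K[i]]_n)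
    (hA : type_II A) (hB : type_II B) :
  [<-> (Nomura A B R /\ S = Theta A B R);
       (Xop R \o Deltaop B \o Xop A =1 Deltaop B \o Xop A \o Deltaop S);
       (Xop R \o Deltaop A \o Xop B =1 Deltaop A \o Xop B \o Deltaop S^T);
       (Deltaop B^T \o Xop (B^(-))^T \o Deltaop (n%:R *: R)
          =1 Xop S^T \o Deltaop (A^(-))^T \o Xop A^T);
       (Deltaop (A^(-))^T \o Xop A^T \o Deltaop (n%:R *: R^T)
          =1 Xop S \o Deltaop B^T \o Xop (B^(-))^T)].
Proof.
have NomuraP := Nomura_eigen R S hA hB.
have eigenP := XDX_eigen A B R S.
have eigenP' := XDX_eigen B A R S^T.
have symP := eigen_eqs_sym A B R S.
have dualP := iff_trans (eigen_eqs_dual R S hA hB) (iff_sym (DXD_dual A B R S)).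
have dualP' := iff_trans (eigen_eqs_dual R S^T hB hA)
                         (iff_sym (DXD_dual_tr A B R S)).
tfae.
- by move=> h; exact: (iffRL eigenP (iffLR NomuraP h)).
- by move=> h; exact: (iffRL eigenP' (iffLR symP (iffLR eigenP h))).
- by move=> h; exact: (iffLR dualP (iffRL symP (iffLR eigenP' h))).
- by move=> h; exact: (iffLR dualP' (iffLR symP (iffRL dualP h))).
- by move=> h; exact: (iffRL NomuraP (iffRL symP (iffRL dualP' h))).
Qed.
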